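(* Let $p,q>0$ be real numbers and let $(\mathcal{S}_n)$ be the generalized Padovan sequence with parameters $p,q$, i.e. $\mathcal{S}_{-2}=0$, $\mathcal{S}_{-1}=0$, $\mathcal{S}_0=1$ and $\mathcal{S}_{n+1}=p\,\mathcal{S}_{n-1}+q\,\mathcal{S}_{n-2}$ for all integers $n\ge 0$. Let $$F=\bigcup_{n=-1}^{\infty}\Big\{(x_{-1},x_0)\in\mathbb{R}^2:\ \mathcal{S}_n x_{-1}+\mathcal{S}_{n-1}x_0x_{-1}+q\,\mathcal{S}_{n-2}=0\Big\}.$$ Let $(x_n)_{n\ge -1}$ be a solution of $$x_{n+1}=\frac{p\,x_{n-1}+q}{x_n x_{n-1}},\qquad n=0,1,2,\ldots,$$ with initial conditions $(x_{-1},x_0)\in\mathbb{R}^2\setminus F$. Then, for $n=1,2,\ldots$, $$x_n=\frac{\mathcal{S}_{n+1}x_{-1}+\mathcal{S}_n x_0x_{-1}+q\,\mathcal{S}_{n-1}}{\mathcal{S}_n x_{-1}+\mathcal{S}_{n-1}x_0x_{-1}+q\,\mathcal{S}_{n-2}}.$$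
   Context: The equation is the rewriting, with $p=\alpha/\gamma$ and $q=\beta/\gamma$, of $x_{n+1}=\dfrac{\alpha x_{n-1}+\beta}{\gamma x_nx_{n-1}}$ with $\alpha,\beta,\gamma>0$. The set $F$ is called the forbidden set of the equation. The value $\mathcal{S}_{-3}$ occurring in the $n=-1$ term of $F$ is obtained by extending the recurrence backwards one step: $\mathcal{S}_0=p\,\mathcal{S}_{-2}+q\,\mathcal{S}_{-3}$, i.e. $\mathcal{S}_{-3}=1/q$. *)

(* Defs.v *)
From HB Require Import structures.
From mathcomp Require Import all_boot all_order all_algebra.
From mathcomp Require Import classical_sets reals.

Set Implicit Arguments.
Unset Strict Implicit.
Unset Printing Implicit Defensive.

Import Order.TTheory GRing.Theory Num.Theory.

Local Open Scope classical_set_scope.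
Local Open Scope ring_scope.

(* Sequences indexed by the integers n >= -k are functions on [int] whose
   values below -k are unconstrained and never used. *)

(* The last clause is the recurrence at n = -1; it extends the sequence one step
   backwards and determines S (-3) = 1 / q, which occurs in the n = -1 term of
   [forbidden_set]. *)
Definition generalized_padovan (R : realType) (p q : R) (S : int -> R) : Prop :=
  [/\ S (-2) = 0, S (-1) = 0, S 0 = 1,
      forall n : int, 0 <= n -> S (n + 1) = p * S (n - 1) + q * S (n - 2)
    & S 0 = p * S (-2) + q * S (-3)].

(* A point z stands for (x_{-1}, x_0). *)
Definition forbidden_set (R : realType) (q : R) (S : int -> R) : set (R * R) :=
  \bigcup_(n in [set n : int | -1 <= n])
    [set z : R * R | S n * z.1 + S (n - 1) * z.2 * z.1 + q * S (n - 2) = 0].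

(* Division is total here (y / 0 = 0), and x n * x (n - 1) != 0 is deliberately
   not required: for initial conditions outside [forbidden_set] it is a
   consequence, not an assumption. *)
Definition is_solution (R : realType) (p q : R) (x : int -> R) : Prop :=
  forall n : int, 0 <= n -> x (n + 1) = (p * x (n - 1) + q) / (x n * x (n - 1)).

(* Main.v *)
(* The denominators D_n = S_n x_{-1} + S_{n-1} x_0 x_{-1} + q S_{n-2} satisfy the
   Padovan recurrence from the initial values D_{-1} = 1, D_0 = x_{-1} and
   D_1 = x_0 x_{-1}, while x_n x_{n-1} telescopes for x_n = D_{n+1} / D_n; so the
   recurrence for x becomes that for D as long as no D_n vanishes, which is what
   avoiding the forbidden set means. *)

Require Import Defs.
From HB Require Import structures.
From mathcomp Require Import all_boot all_order all_algebra.
From mathcomp Require Import classical_sets reals.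
From mathcomp Require Import ring zify.

Set Implicit Arguments.
Unset Strict Implicit.
Unset Printing Implicit Defensive.

Import Order.TTheory GRing.Theory Num.Theory.

Local Open Scope classical_set_scope.
Local Open Scope ring_scope.

Definition padovan_comb (R : realType) (q : R) (S : int -> R) (a b : R)
    (n : int) : R :=
  S n * a + S (n - 1) * b * a + q * S (n - 2).

Section PadovanComb.
Variables (R : realType) (p q : R) (S : int -> R) (a b : R).
Hypothesis hS : generalized_padovan p q S.

Local Notation D := (padovan_comb q S a b).

(** The backward clause on [S (-3)] supplies [n = -1]; [padovan_comb_rec] needs this case at
    [n = 1], to expand the last term of [D (n + 1)]. *)
Lemma padovan_rec (n : int) :
  -1 <= n -> S (n + 1) = p * S (n - 1) + q * S (n - 2).
Proof.
case: hS => [_ _ _ Srec S0rec]; rewrite le_eqVlt => /orP[/eqP <- //|n_gt].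
by apply: Srec; lia.
Qed.

Lemma padovan_comb_rec (n : int) :
  1 <= n -> D (n + 1) = p * D (n - 1) + q * D (n - 2).
Proof.
move=> n1; rewrite /padovan_comb padovan_rec; last by lia.
have -> : n + 1 - 1 = n - 1 + 1 by lia.
have -> : n + 1 - 2 = n - 2 + 1 by lia.
rewrite [S (n - 1 + 1)]padovan_rec; last by lia.
rewrite [S (n - 2 + 1)]padovan_rec; last by lia.
have -> : n - 1 - 2 = n - 2 - 1 by lia.
by rewrite (_ : n - 1 - 1 = n - 2); [ring | lia].
Qed.

Lemma padovan_combN1 : D (-1) = 1.
Proof.
(* Only the term [q * S (-3)] survives, and the backward clause makes it [S 0 = 1]. *)
case: hS => [SN2 SN1 S0 _]; rewrite S0 SN2 mulr0 add0r => S0rec.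
by rewrite /padovan_comb SN1 SN2 !mul0r !add0r S0rec.
Qed.

Lemma padovan_comb0 : D 0 = a.
Proof.
by case: hS => [SN2 SN1 S0 _ _]; rewrite /padovan_comb S0 SN1 SN2; ring.
Qed.

Lemma padovan_comb1 : D 1 = b * a.
Proof.
case: hS => [SN2 SN1 S0 Srec _].
have S1 : S 1 = 0 by rewrite (Srec 0 (lexx _)) SN1 SN2 !mulr0 addr0.
by rewrite /padovan_comb S1 S0 SN1; ring.
Qed.

End PadovanComb.

Lemma solution_padovan_ratio (R : realType) (p q : R) (S x : int -> R)
    (D := padovan_comb q S (x (-1)) (x 0)) :
    generalized_padovan p q S -> is_solution p q x ->
    (forall n : int, -1 <= n -> D n != 0) ->
  forall k : nat, x k%:Z = D (k%:Z + 1) / D k%:Z.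
Proof.
move=> hS hx D_neq0 k.
(* The recurrence for [x] reaches back two terms, so the induction carries two consecutive
   ratios. *)
suff [] : x (k%:Z - 1) = D k%:Z / D (k%:Z - 1) /\
          x k%:Z = D (k%:Z + 1) / D k%:Z by [].
elim: k => [|k [IHpred IHk]].
  (* Needed to cancel [x (-1)] in [D 1 / D 0]. *)
  have a_neq0 : x (-1) != 0.
    by have := D_neq0 0 isT; rewrite /D (padovan_comb0 _ _ hS).
  rewrite !add0r /D (padovan_combN1 _ _ hS) (padovan_comb0 _ _ hS).
  by rewrite (padovan_comb1 _ _ hS) divr1 mulfK.
have -> : k.+1%:Z - 1 = k%:Z by lia.
have -> : k.+1%:Z = k%:Z + 1 by lia.
split=> //; rewrite hx // IHpred IHk.
rewrite [D (k%:Z + 1 + 1)](padovan_comb_rec _ _ hS); last by lia.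
have -> : k%:Z + 1 - 1 = k%:Z by lia.
have -> : k%:Z + 1 - 2 = k%:Z - 1 by lia.
(* Clearing denominators requires [D] nonzero at [k - 1], [k] and [k + 1]; the lowest index reached
   is -1, at [k = 0]. *)
rewrite -/D; field.
by rewrite !D_neq0 //; lia.
Qed.

Theorem theorem2 (R : realType) (p q : R) (S x : int -> R)
    (hp : 0 < p) (hq : 0 < q)
    (hS : generalized_padovan p q S)
    (hx : is_solution p q x)
    (hF : (~` forbidden_set q S) (x (-1), x 0)) :
  forall n : int, 1 <= n ->
    x n = (S (n + 1) * x (-1) + S n * x 0 * x (-1) + q * S (n - 1))
          / (S n * x (-1) + S (n - 1) * x 0 * x (-1) + q * S (n - 2)).
Proof.
case=> // k _; rewrite (solution_padovan_ratio hS hx) => [|m m_ge].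
  rewrite /padovan_comb addrK.
  by rewrite (_ : k%:Z + 1 - 2 = k%:Z - 1) // -addrA.
(* A zero of the denominator at [m] puts the initial point in the [m]-th set of the union. *)
by apply/eqP => Dm0; apply: hF; exists m.
Qed.
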